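(* Let $x:(I,q)\to\mathbb{R}^2$ be a polarised curve with lift $L:(I,q)\to\mathbb{P}(\mathcal{L})$, and let $\mathfrak{q}\in\mathbb{R}^{3,1}$ be a constant vector. Then $x$ is polarised by space form arc-length determined by $\mathfrak{q}$ if and only if the lift $L$ of $x$ admits a linear conserved quantity of the form $$p^t=\mathfrak{q}+tX$$ for $X\in\Gamma L$ taking values in $M:=\{X\in\mathcal{L}:(X,\mathfrak{q})=-1\}$.
   Context: $\mathbb{R}^{3,1}$ is $\mathbb{R}^4$ with a symmetric bilinear form $(\cdot,\cdot)$ of signature $(-+++)$; $\mathcal{L}=\{X\in\mathbb{R}^{3,1}:(X,X)=0\}$ is the lightcone, and $\mathbb{P}(\mathcal{L})$ is its projectivisation (the lines $\langle X\rangle$ with $0\neq X\in\mathcal{L}$), the conformal $2$-sphere. For $x,y\in\mathbb{R}^{3,1}$, $x\wedge y\in\mathfrak{o}(3,1)$ is the map $(x\wedge y)v=(x,v)y-(y,v)x$. Polarised curve: a (smooth) regular curve on an open interval $I$ equipped with a non-vanishing quadratic differential $q$, i.e. $q=\frac1m\,\mathrm{d}s^2$ in a coordinate $s$, with $m$ a non-vanishing real function. (Note the distinction between the quadratic differential $q$ and the vector $\mathfrak{q}$.) Lift: fix $\check{\mathfrak{q}},\mathfrak{o}\in\mathcal{L}$ with $(\mathfrak{o},\check{\mathfrak{q}})=-1$ and identify $\mathbb{R}^2\cong\langle\mathfrak{o},\check{\mathfrak{q}}\rangle^\perp$, with $|x|^2=(x,x)$. The lift of $x:(I,q)\to\mathbb{R}^2$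 is $L=\langle\check X\rangle$ with $\check X=x+\mathfrak{o}+\frac12|x|^2\check{\mathfrak{q}}$, regarded as a line subbundle of $I\times\mathbb{R}^{3,1}$; $\Gamma L$ denotes its sections. Associated flat connections: $\mathrm{d}^t=\mathrm{d}+t\eta$, $t\in\mathbb{R}$, with $\eta=q\,\frac{X\wedge \mathrm{d}X}{(\mathrm{d}X,\mathrm{d}X)}$ for any nowhere vanishing $X\in\Gamma L$ (independent of the choice of $X$). A polynomial conserved quantity of $L$ is $p^t=p_0+p_1t+\dots+p_dt^d$, with $p_n:I\to\mathbb{R}^{3,1}$ smooth, such that $(\mathrm{d}+t\eta)p^t=0$ for all $t$; it is linear if $d=1$. Space form arc-length polarisation: $L$ is polarised by space form arc-length determined by the constant vector $\mathfrak{q}$ if there is $X\in\Gamma L$ with $(X,\mathfrak{q})=-1$ and $q=(\mathrm{d}X,\mathrm{d}X)$. A curve $x:(I,q)\to\mathbb{R}^2$ is said to be polarised by space form arc-length determined by $\mathfrak{q}$ if its lift $L$ is. *)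

(* Defs.v *)
From HB Require Import structures.
From mathcomp Require Export all_boot all_order all_algebra sesquilinear.
From mathcomp Require Export all_classical all_reals all_analysis.
Export Order.TTheory GRing.Theory Num.Theory.
Export numFieldNormedType.Exports.

Set Implicit Arguments.
Unset Strict Implicit.
Unset Printing Implicit Defensive.

Global Open Scope classical_set_scope.
Global Open Scope ring_scope.

(* Signature (-+++).  Four vectors with this Gram matrix are automatically
   linearly independent, hence a basis of R^4. *)
Definition lorentzian (R : realType) (B : {symmetric 'rV[R]_4}) : Prop :=
  exists e : 'I_4 -> 'rV[R]_4, forall i j : 'I_4,
    B (e i) (e j) = if i == j then (if i == ord0 then -1 else 1) else 0.

Definition lightcone (R : realType) (B : {symmetric 'rV[R]_4}) :
  set 'rV[R]_4 := [set X | B X X = 0].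

Definition wedge (R : realType) (B : {symmetric 'rV[R]_4})
  (x y v : 'rV[R]_4) : 'rV[R]_4 := B x v *: y - B y v *: x.

Definition open_interval (R : realType) (I : set R) : Prop :=
  [/\ I !=set0, open I & is_interval I].

(* Maps on the open interval I are represented by total functions on R, of which
   only the values on I matter. *)
Definition smooth_on (R : realType) (V : normedModType R) (I : set R)
  (f : R -> V) : Prop :=
  forall (n : nat) (s : R), I s -> derivable (derive1n n f) s 1.

(* A quadratic differential q = (1/m) ds^2 is given by m, where s is the
   standard coordinate of I; qcoef m s is its coefficient at s.  Likewise,
   1-forms are given by their coefficient of ds, i.e. their value on d/ds. *)
Definition qcoef (R : realType) (m : R -> R) (s : R) : R := (m s)^-1.

Definition polarised_curve (R : realType) (n : nat) (I : set R) (m : R -> R)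
  (x : R -> 'rV[R]_n.+1) : Prop :=
  [/\ smooth_on I x, forall s, I s -> derive1 x s != 0 &
      forall s, I s -> m s != 0].

(* iota : R^2 -> R^{3,1} is a linear isometry onto the orthogonal complement of
   the span of o and qv; these are null with (o, qv) = -1. *)
Definition euclidean_model (R : realType) (B : {symmetric 'rV[R]_4})
  (qv o : 'rV[R]_4) (iota : {linear 'rV[R]_2 -> 'rV[R]_4}) : Prop :=
  [/\ lightcone B qv, lightcone B o, B o qv = -1,
      forall u v : 'rV[R]_2, B (iota u) (iota v) = \sum_i u 0 i * v 0 i &
      forall v : 'rV[R]_4,
        (B v o = 0 /\ B v qv = 0) <-> (exists u : 'rV[R]_2, v = iota u)].

Definition lift_vector (R : realType) (B : {symmetric 'rV[R]_4})
  (qv o : 'rV[R]_4) (iota : {linear 'rV[R]_2 -> 'rV[R]_4})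
  (x : R -> 'rV[R]_2) (s : R) : 'rV[R]_4 :=
  iota (x s) + o + (2^-1 * B (iota (x s)) (iota (x s))) *: qv.

Definition lift_bundle (R : realType) (B : {symmetric 'rV[R]_4})
  (qv o : 'rV[R]_4) (iota : {linear 'rV[R]_2 -> 'rV[R]_4})
  (x : R -> 'rV[R]_2) (s : R) : {vspace 'rV[R]_4} :=
  <[lift_vector B qv o iota x s]>%VS.

Definition bundle_section (R : realType) (I : set R)
  (L : R -> {vspace 'rV[R]_4}) (X : R -> 'rV[R]_4) : Prop :=
  smooth_on I X /\ forall s, I s -> X s \in L s.

Definition nowhere_vanishing (R : realType) (I : set R)
  (X : R -> 'rV[R]_4) : Prop := forall s, I s -> X s != 0.

(* The coefficient of ds in eta = q (X /\ dX) / (dX, dX). *)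
Definition eta (R : realType) (B : {symmetric 'rV[R]_4}) (m : R -> R)
  (X : R -> 'rV[R]_4) (s : R) (v : 'rV[R]_4) : 'rV[R]_4 :=
  (qcoef m s / B (derive1 X s) (derive1 X s)) *: wedge B (X s) (derive1 X s) v.

(* The coefficient of ds in (d + t eta) p. *)
Definition flat_connection (R : realType) (B : {symmetric 'rV[R]_4})
  (m : R -> R) (X : R -> 'rV[R]_4) (t : R) (p : R -> 'rV[R]_4) (s : R) :
  'rV[R]_4 := derive1 p s + t *: eta B m X s (p s).

(* p is the list of coefficients [:: p_0; ...; p_d]. *)
Definition poly_at (R : realType) (p : seq (R -> 'rV[R]_4)) (t s : R) :
  'rV[R]_4 := \sum_(n < size p) t ^+ n *: nth (fun=> 0) p n s.

(* The connections d + t eta do not depend on the nowhere vanishing section Y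
   defining eta. *)
Definition polynomial_conserved_quantity (R : realType)
  (B : {symmetric 'rV[R]_4}) (I : set R) (m : R -> R)
  (L : R -> {vspace 'rV[R]_4}) (p : seq (R -> 'rV[R]_4)) : Prop :=
  (forall n : nat, (n < size p)%N -> smooth_on I (nth (fun=> 0) p n)) /\
  forall Y : R -> 'rV[R]_4, bundle_section I L Y -> nowhere_vanishing I Y ->
  forall t s : R, I s -> flat_connection B m Y t (poly_at p t) s = 0.

Definition linear_conserved_quantity (R : realType)
  (B : {symmetric 'rV[R]_4}) (I : set R) (m : R -> R)
  (L : R -> {vspace 'rV[R]_4}) (p : seq (R -> 'rV[R]_4)) : Prop :=
  size p = 2%N /\ polynomial_conserved_quantity B I m L p.

Definition polarised_by_space_form_arclength (R : realType)
  (B : {symmetric 'rV[R]_4}) (I : set R) (m : R -> R)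
  (L : R -> {vspace 'rV[R]_4}) (q : 'rV[R]_4) : Prop :=
  exists X : R -> 'rV[R]_4,
    [/\ bundle_section I L X,
        forall s, I s -> B (X s) q = -1 &
        forall s, I s -> qcoef m s = B (derive1 X s) (derive1 X s)].

Definition curve_polarised_by_space_form_arclength (R : realType)
  (B : {symmetric 'rV[R]_4}) (qv o : 'rV[R]_4)
  (iota : {linear 'rV[R]_2 -> 'rV[R]_4}) (I : set R) (m : R -> R)
  (x : R -> 'rV[R]_2) (q : 'rV[R]_4) : Prop :=
  polarised_by_space_form_arclength B I m (lift_bundle B qv o iota x) q.

Definition space_form (R : realType) (B : {symmetric 'rV[R]_4})
  (q : 'rV[R]_4) : set 'rV[R]_4 := [set X | lightcone B X /\ B X q = -1].

(* Main.v *)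
(* If X is a section with (X, q) = -1, then (X, X) = 0 and the constancy of
   (X, q) give (X, X') = (X', q) = 0, so that (X /\ X')(q + t X) = - X' and
   (d + t eta)(q + t X) = t (1 - q_2 / (X', X')) X', where q_2 is the coefficient
   of the quadratic differential. As eta is independent of the section used to
   define it and X' never vanishes (regularity of x), this is zero for all t
   exactly when q_2 = (X', X'). *)
From mathcomp Require Import ring.
Require Import Defs.

Set Implicit Arguments.
Unset Strict Implicit.
Unset Printing Implicit Defensive.

(** * Differentiation of vector-valued maps and of the form along them *)

Lemma is_derive_mxP (R : realFieldType) (V : normedModType R) (m n : nat)
  (M : V -> 'M[R]_(m, n)) (dM : 'M[R]_(m, n)) (t v : V) :
  is_derive t v M dM <->
  forall i j, is_derive t v (fun s => M s i j) (dM i j).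
Proof.
split=> [MdM i j|MdM].
  have Mv : derivable M t v by case: MdM.
  apply: DeriveDef; first exact: (derivable_mxP M t v).1.
  by have := @derive_val _ _ _ _ _ _ _ MdM; rewrite derive_mx// => <-; rewrite mxE.
have Mv : derivable M t v by apply/derivable_mxP => i j; case: (MdM i j).
apply: DeriveDef => //; rewrite derive_mx//; apply/matrixP => i j.
by rewrite mxE; case: (MdM i j).
Qed.

Lemma is_derive_scale (R : realFieldType) (V : normedModType R) (n : nat)
  (f : V -> R) (X : V -> 'rV[R]_n) (df : R) (dX : 'rV[R]_n) (t v : V) :
  is_derive t v f df -> is_derive t v X dX ->
  is_derive t v (fun s => f s *: X s) (f t *: dX + df *: X t).
Proof.
move=> fdf /is_derive_mxP XdX; apply/is_derive_mxP => i j.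
rewrite (_ : (fun s => _) = f * (fun s => X s i j)); last first.
  by apply/funext => s; rewrite mxE.
apply: (is_derive_eq (is_deriveM fdf (XdX i j))).
by rewrite !mxE /GRing.scale /= [X in _ + X]mulrC.
Qed.

Lemma is_derive_form (R : realType) (n : nat)
  (B : {symmetric 'rV[R]_n}) (V : normedModType R)
  (X Y : V -> 'rV[R]_n) (dX dY : 'rV[R]_n) (t v : V) :
  is_derive t v X dX -> is_derive t v Y dY ->
  is_derive t v (fun s => B (X s) (Y s)) (B dX (Y t) + B (X t) dY).
Proof.
move=> /is_derive_mxP XdX /is_derive_mxP YdY.
(* Expanding in the standard basis reduces the claim to the product rule for real functions, with
   the Gram matrix as constant coefficients. *)
have BE u w : B u w = \sum_i \sum_j u 0 i * w 0 j * B 'e_i 'e_j.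
  rewrite {1}[u]row_sum_delta linear_sumlz; apply: eq_bigr => i _.
  rewrite linearZl_LR {1}[w]row_sum_delta linear_sumr mulr_sumr.
  by apply: eq_bigr => j _; rewrite linearZr_LR /= mulrA.
rewrite (_ : (fun s => _) = \sum_i \sum_j
    (fun s => X s 0 i) * (fun s => Y s 0 j) * cst (B 'e_i 'e_j)); last first.
  apply/funext => s; rewrite BE fct_sumE; apply: eq_bigr => i _.
  by rewrite fct_sumE.
apply: is_derive_eq.
rewrite !BE -big_split /=; apply: eq_bigr => i _.
rewrite -big_split /=; apply: eq_bigr => j _.
rewrite scaler0 add0r /GRing.scale/=; ring.
Qed.

(** Since [I] is open, agreement on [I] is agreement near [s]. This is how identities known only on
    [I] get differentiated. *)
Lemma is_derive_eq_on (R : realType) (V : normedModType R) (I : set R)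
  (f g : R -> V) (s : R) (df dg : V) :
  open I -> I s -> {in I, f =1 g} ->
  is_derive s 1 f df -> is_derive s 1 g dg -> df = dg.
Proof.
move=> oI Is fg fdf gdg.
have fgs : \near s, f s = g s.
  apply: filterS (open_nbhs_nbhs (conj oI Is)) => r Ir; apply: fg.
  exact: mem_set.
have := @near_eq_derive _ _ _ f g s 1 fgs.
by rewrite (@derive_val _ _ _ _ _ _ _ fdf) (@derive_val _ _ _ _ _ _ _ gdg).
Qed.

Lemma smooth_on_is_derive (R : realType) (V : normedModType R) (I : set R)
  (f : R -> V) (s : R) :
  smooth_on I f -> I s -> is_derive s 1 f (derive1 f s).
Proof. by move=> sf Is; rewrite derive1E; apply/derivableP/(sf 0%N). Qed.

Lemma smooth_on_cst (R : realType) (V : normedModType R) (I : set R) (v : V) :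
  smooth_on I (fun=> v).
Proof.
move=> n s _; suff [w ->] : exists w, derive1n n (fun=> v) = cst w.
  exact: derivable_cst.
elim: n => [|n [w IHn]]; first by exists v.
by exists 0; rewrite derive1nS IHn; apply/funext => r; rewrite derive1_cst.
Qed.

Lemma symC (R : realType) (U : lmodType R) (B : {symmetric U}) (u v : U) :
  B u v = B v u.
Proof. by rewrite hermC expr0 mul1r. Qed.

(** * Sections taking values in the space form *)

Section SpaceFormLift.
Variables (R : realType) (B : {symmetric 'rV[R]_4}) (q : 'rV[R]_4).
Variables (I : set R) (X : R -> 'rV[R]_4).
Hypotheses (openI : open I) (smoothX : smooth_on I X).
Hypothesis XM : forall s, I s -> space_form B q (X s).

Lemma space_form_derive_perp (s : R) : I s -> B (derive1 X s) q = 0.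
Proof.
move=> Is; have Xd := smooth_on_is_derive smoothX Is.
have := is_derive_form B Xd (is_derive_cst q s 1).
rewrite linear0r addr0 => Bd.
apply: (is_derive_eq_on openI Is _ Bd (is_derive_cst (-1 : R) s 1)) => r.
by move/set_mem => /XM[].
Qed.

Lemma null_derive_perp (s : R) : I s -> B (X s) (derive1 X s) = 0.
Proof.
move=> Is; have Xd := smooth_on_is_derive smoothX Is.
have Bd := is_derive_form B Xd Xd.
suff : B (derive1 X s) (X s) + B (X s) (derive1 X s) = 0.
  by rewrite symC -mulr2n => /eqP; rewrite mulrn_eq0 => /eqP.
apply: (is_derive_eq_on openI Is _ Bd (is_derive_cst (0 : R) s 1)) => r.
by move/set_mem => /XM[].
Qed.

(** This is valid even where (X', X') = 0, the inverse of 0 being 0, so the converse direction can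
    apply it before knowing that (X', X') is nonzero. *)
Lemma flat_connection_space_form (m : R -> R) (t s : R) : I s ->
  flat_connection B m X t (poly_at [:: fun=> q; X] t) s =
  (t * (1 - qcoef m s / B (derive1 X s) (derive1 X s))) *: derive1 X s.
Proof.
move=> Is; have [X0 Xq] := XM Is.
have pE : poly_at [:: fun=> q; X] t = cst q + t \*: X.
  by apply/funext => r; rewrite /poly_at !big_ord_recl big_ord0 /= expr0 scale1r
    expr1 addr0.
have dp : derive1 (poly_at [:: fun=> q; X] t) s = t *: derive1 X s.
  have Xd := smooth_on_is_derive smoothX Is.
  have := is_deriveD (is_derive_cst q s 1) (is_deriveZ t Xd).
  by rewrite -pE add0r => -[_]; rewrite -derive1E.
rewrite /flat_connection dp pE /eta /wedge /= [(_ + _) s]/GRing.add /=.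
rewrite !linearDr !linearZr_LR /= Xq X0 space_form_derive_perp//.
rewrite (symC B (derive1 X s) (X s)) null_derive_perp//.
rewrite mulr0 !addr0 scale0r subr0; apply/rowP => i; rewrite !mxE; ring.
Qed.

(** Write Y = f X with f = - (Y, q), which is differentiable because Y is. Then Y' = f X' + f' X.
    The f' term drops out of the wedge by antisymmetry and out of (Y', Y') because X is null and
    orthogonal to X'. Both scale by f^2, which cancels. *)
Lemma eta_section (m : R -> R) (Y : R -> 'rV[R]_4) (s : R) (v : 'rV[R]_4) :
  smooth_on I Y -> (forall r, I r -> Y r = - B (Y r) q *: X r) ->
  I s -> Y s != 0 -> eta B m Y s v = eta B m X s v.
Proof.
move=> smoothY YX Is Ys0; have [X0 _] := XM Is.
have Xd := smooth_on_is_derive smoothX Is.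
have Yd := smooth_on_is_derive smoothY Is.
set f := fun r => - B (Y r) q.
have fd : is_derive s 1 f (- (B (derive1 Y s) q + B (Y s) 0)).
  exact: is_deriveN (is_derive_form B Yd (is_derive_cst q s 1)).
have dY : derive1 Y s = f s *: derive1 X s + - (B (derive1 Y s) q + B (Y s) 0) *: X s.
  apply: is_derive_eq_on openI Is _ Yd (is_derive_scale fd Xd) => r.
  by move/set_mem/YX.
have Ys : Y s = f s *: X s by exact: YX.
have f0 : f s != 0 by apply: contraNneq Ys0 => f0; rewrite Ys f0 scale0r.
move: dY; set df := - _; move=> dY; rewrite /eta /wedge dY Ys.
clearbody f df.
have XX' := null_derive_perp Is.
rewrite !(linearDl, linearDr, linearZl_LR, linearZr_LR) /= XX'.
rewrite (symC B (derive1 X s) (X s)) XX' X0.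
set b := B _ _; set a := B (X s) v; set c := B (derive1 X s) v.
rewrite (_ : _ + _ + _ = f s * (f s * b)); last first.
  by rewrite !mulr0 !scaler0 !addr0.
transitivity ((qcoef m s / (f s * (f s * b)) * f s ^+ 2) *:
    (a *: derive1 X s - c *: X s)).
  by apply/rowP => i; rewrite !mxE; ring.
(* The inverse of [b] is made opaque because [b] may vanish; only [f s] has to be nonzero. *)
by congr (_ *: _); rewrite !invfM; move: (b^-1) => b'; field.
Qed.

End SpaceFormLift.

(** * Nullity and regularity of the Euclidean lift *)

Section Lift.
Variables (R : realType) (B : {symmetric 'rV[R]_4}).
Variables (qv o : 'rV[R]_4) (iota : {linear 'rV[R]_2 -> 'rV[R]_4}).
Hypothesis hmodel : euclidean_model B qv o iota.

Lemma lift_bundle_null (x : R -> 'rV[R]_2) (s : R) (v : 'rV[R]_4) :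
  v \in lift_bundle B qv o iota x s -> B v v = 0.
Proof.
have [qv0 o0 oqv _ perp] := hmodel.
have [uo uqv] : B (iota (x s)) o = 0 /\ B (iota (x s)) qv = 0.
  by apply/perp; exists (x s).
move=> /vlineP[k ->]; rewrite /lift_vector.
rewrite !(linearDl, linearDr, linearZl_LR, linearZr_LR) /=.
rewrite (symC B qv o) (symC B o (iota _)) (symC B qv (iota _)) uo uqv oqv o0 qv0.
by rewrite /GRing.scale/=; field.
Qed.

(* Along a section the ratio of the components [(X, iota u)] and [- (X, qv)] is
   [(x, u)]; for u = x', if X' vanished, so would [(x', x')]. *)
Lemma lift_section_derive_neq0 (I : set R) (x : R -> 'rV[R]_2)
  (X : R -> 'rV[R]_4) (s : R) :
  open I -> smooth_on I x -> bundle_section I (lift_bundle B qv o iota x) X ->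
  I s -> X s != 0 -> derive1 x s != 0 -> derive1 X s != 0.
Proof.
move=> oI smoothx [smoothX XL] Is Xs0; apply: contraNneq => X'0.
have [qv0 o0 oqv isom perp] := hmodel.
have uo u : B (iota u) o = 0 /\ B (iota u) qv = 0 by apply/perp; exists u.
(* The lift vector pairs to -1 with [qv], which determines the factor. *)
have Xqv r : I r -> X r = - B (X r) qv *: lift_vector B qv o iota x r.
  move=> /XL /vlineP[k ->]; congr (_ *: _).
  rewrite /lift_vector !(linearDl, linearZl_LR) /= (uo _).2 oqv qv0
    /GRing.scale/=; ring.
have xd := smooth_on_is_derive smoothx Is.
have Xd : is_derive s 1 X 0.
  by have := smooth_on_is_derive smoothX Is; rewrite X'0.
(* The vector [u] is frozen at [s], so it is constant in the identities below that are
   differentiated in [r]. *)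
pose u := derive1 x s.
have BXu r : I r -> B (X r) (iota u) = - B (X r) qv * (\sum_i x r 0 i * u 0 i).
  move=> Ir; rewrite {1}(Xqv _ Ir) /lift_vector !(linearDl, linearZl_LR) /=.
  by rewrite (symC B o) (symC B qv) (uo _).1 (uo _).2 mulr0 scaler0 !addr0 isom.
have fd := is_deriveN (is_derive_form B Xd (is_derive_cst qv s 1)).
have gd : is_derive s 1 (fun r => \sum_i x r 0 i * u 0 i) (\sum_i u 0 i * u 0 i).
  have /is_derive_mxP xid := xd.
  rewrite (_ : (fun r => _) = \sum_i (fun r => x r 0 i) * cst (u 0 i)); last first.
    by apply/funext => r; rewrite fct_sumE.
  apply: is_derive_eq; apply: eq_bigr => i _.
  by rewrite scaler0 add0r.
(* As X' vanishes at [s], so do the derivatives of (X, iota u) and of (X, qv); what remains is - (X,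
   qv) (u, u) = 0. *)
have := is_derive_eq_on oI Is (fun r Ir => BXu r (set_mem Ir))
  (is_derive_form B Xd (is_derive_cst (iota u) s 1)) (is_deriveM fd gd).
rewrite !(linear0l, linear0r) !addr0 oppr0 scaler0 addr0 => /esym/eqP.
rewrite mulf_eq0 => /orP[|].
  rewrite [X in X == 0](_ : _ = - B (X s) qv)// => /eqP f0.
  by move: Xs0; rewrite (Xqv _ Is) f0 scale0r eqxx.
rewrite psumr_eq0 => [/allP u0|i _]; last exact: sqr_ge0.
apply/eqP/rowP => i; have := u0 i (mem_index_enum _).
by rewrite mulf_eq0 orbb mxE => /eqP.
Qed.

End Lift.

Theorem theorem4p5 (R : realType) (B : {symmetric 'rV[R]_4})
  (hB : lorentzian B)
  (qv o : 'rV[R]_4) (iota : {linear 'rV[R]_2 -> 'rV[R]_4})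
  (hmodel : euclidean_model B qv o iota)
  (I : set R) (hI : open_interval I)
  (m : R -> R) (x : R -> 'rV[R]_2) (hx : polarised_curve I m x)
  (q : 'rV[R]_4) :
  curve_polarised_by_space_form_arclength B qv o iota I m x q <->
  exists X : R -> 'rV[R]_4,
    [/\ bundle_section I (lift_bundle B qv o iota x) X,
        forall s, I s -> space_form B q (X s) &
        linear_conserved_quantity B I m (lift_bundle B qv o iota x)
          [:: fun=> q; X]].
Proof.
have [_ oI _] := hI; have [sx x'0 m0] := hx.
set L := lift_bundle B qv o iota x.
(* Both vectors lie on one line, and pairing with [q] recovers the factor because (X, q) = -1. *)
have sectionE X Y r : X r \in L r -> Y r \in L r -> B (X r) q = -1 ->
    Y r = - B (Y r) q *: X r.
  move=> /vlineP[a ->] /vlineP[b ->]; rewrite !linearZl_LR /= => ac.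
  by rewrite scalerA -mulNr mulrAC -mulrA ac mulrN1 opprK.
have M_neq0 (Y : 'rV[R]_4) : space_form B q Y -> Y != 0.
  by case=> _; apply: contra_eq_neq => ->; rewrite linear0l eq_sym oppr_eq0 oner_eq0.
split=> [[X [[smoothX XL] Xq mX]]|[X [secX XM [_ [_ pX]]]]].
  have XM s : I s -> space_form B q (X s).
    by move=> Is; split; [exact: (lift_bundle_null hmodel (XL _ Is))|exact: Xq].
  exists X; split; [by split|exact: XM|split; first by []].
  split=> [[|[|n]] ltn2|Y [smoothY YL] Y0 t s Is].
  - exact: smooth_on_cst.
  - exact: smoothX.
  - by case: (notF ltn2).
  have YX r : I r -> Y r = - B (Y r) q *: X r.
    by move=> Ir; apply: sectionE; [exact: XL|exact: YL|exact: Xq].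
  (* Conservation is required for [eta] built from any [Y]; it is transferred to the section [X]. *)
  rewrite /flat_connection (eta_section oI smoothX XM m _ smoothY YX Is (Y0 s Is)).
  have := flat_connection_space_form oI smoothX XM m t Is.
  rewrite /flat_connection => ->.
  (* The quotient is 1 because the polarisation does not vanish. *)
  by rewrite -mX// divff ?invr_eq0 ?m0// subrr mulr0 scale0r.
exists X; split=> // s Is; first by case: (XM s Is).
have Xs0 := M_neq0 _ (XM s Is).
have X0 : nowhere_vanishing I X by move=> r /XM; exact: M_neq0.
have X'0 := lift_section_derive_neq0 hmodel oI sx secX Is Xs0 (x'0 s Is).
(* The value t = 1, with [X] itself defining [eta], already suffices. *)
have /eqP := pX X secX X0 1 s Is.
rewrite (flat_connection_space_form oI secX.1 XM)// mul1r scaler_eq0.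
rewrite (negPf X'0) orbF subr_eq0 => /eqP mX.
(* Otherwise the quotient in [mX] would be 0 by the convention for the inverse of 0, whereas it
   equals 1. *)
have b0 : B (derive1 X s) (derive1 X s) != 0.
  by apply: contra_eq_neq mX => ->; rewrite invr0 mulr0 oner_eq0.
by rewrite -[LHS](divfK b0) -mX mul1r.
Qed.
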